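(* For each infinite cardinal number $\mathfrak{m}$, there exist $2^{\mathfrak{m}}$ many pairwise non-homeomorphic metric spaces of cardinality $\mathfrak{m}$, each of which has empty $\mathfrak{m}$-derivative.
   Context: For a topological space $X$ the $\alpha$-derivative $X^{(\alpha)}$ is defined by transfinite induction: $X^{(0)} = X$; $X^{(\alpha+1)}$ is the set of points of $X^{(\alpha)}$ that are not isolated in $X^{(\alpha)}$; and $X^{(\alpha)} = \bigcap\{X^{(\beta)} : \beta<\alpha\}$ for limit $\alpha$. In ''$\mathfrak{m}$-derivative'' the cardinal $\mathfrak{m}$ is regarded as an (initial) ordinal. *)

(* Defs.v *)
From mathcomp Require Export all_boot all_order all_algebra.
From mathcomp Require Export wochoice all_classical all_reals topology.
Set Implicit Arguments.
Unset Strict Implicit.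
Unset Printing Implicit Defensive.
Local Open Scope classical_set_scope.
Local Open Scope card_scope.

(* An ordinal is represented as an element w of a type W carrying a (reflexive)
   well-order le: w stands for the order type of its strict initial segment. *)
Section Ordinals.
Variables (W : eqType) (le : rel W).

Definition olt (v w : W) : Prop := le v w /\ v <> w.

Definition segment (w : W) : set W := [set v | olt v w].

Definition is_zero (w : W) : Prop := forall v, ~ olt v w.

Definition is_succ (v w : W) : Prop :=
  olt v w /\ forall u, olt u w -> le u v.

Definition is_limit (w : W) : Prop :=
  ~ is_zero w /\ forall v, ~ is_succ v w.

(* w is the cardinal #|M| regarded as an initial ordinal: it has cardinality
   #|M| and no smaller ordinal does. *)
Definition is_initial_ordinal (M : Type) (w : W) : Prop :=
  segment w #= [set: M] /\ forall v, olt v w -> ~ (segment v #= [set: M]).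

Hypothesis wo : well_order le.

Lemma wo_total v w : le v w \/ le w v.
Proof.
have [|z [[zA zmin] _]] := wo (A := fun u => (u == v) || (u == w)).
  by exists v; rewrite unfold_in eqxx.
move: zA; rewrite unfold_in => /orP[] /eqP ez; subst z.
  by left; apply: zmin; rewrite unfold_in eqxx orbT.
by right; apply: zmin; rewrite unfold_in eqxx.
Qed.

Lemma wo_anti v w : le v w -> le w v -> v = w.
Proof.
move=> vw wv; have vv : le v v by case: (wo_total v v).
have ww : le w w by case: (wo_total w w).
have [|z [_ zu]] := wo (A := fun u => (u == v) || (u == w)).
  by exists v; rewrite unfold_in eqxx.
have <- : z = v.
  by apply: zu; split=> [|u]; rewrite unfold_in ?eqxx // => /orP[]/eqP->.
apply: zu; split=> [|u]; rewrite unfold_in ?eqxx ?orbT // => /orP[]/eqP-> //.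
Qed.

Lemma wo_min (P : W -> Prop) :
  (exists w, P w) -> exists2 w, P w & forall v, P v -> le w v.
Proof.
case=> w Pw; have [|z [[zA zmin] _]] := wo (A := fun u => `[< P u >]).
  by exists w; rewrite unfold_in; apply/asboolP.
exists z; first by move: zA; rewrite unfold_in => /asboolP.
by move=> v Pv; apply: zmin; rewrite unfold_in; apply/asboolP.
Qed.

Lemma olt_wf : well_founded olt.
Proof.
move=> w; apply: contrapT => nw.
have [|z nz zmin] := wo_min (P := fun w => ~ Acc olt w); first by exists w.
apply: nz; constructor=> v [vz nvz]; apply: contrapT => nv.
by apply: nvz; apply: wo_anti vz (zmin _ nv).
Qed.

Lemma succ_uniq u v w : is_succ u w -> is_succ v w -> u = v.
Proof. by move=> [uw umax] [vw vmax]; apply: wo_anti; [exact: vmax|exact: umax]. Qed.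

Variable X : topologicalType.

(* The three cases of the definition of X^(w). There is at most one v such that
   is_succ v w, so the intersection in the successor case is over one set. *)
Definition derivative_step (w : W) (D : forall v, olt v w -> set X) : set X :=
  if `[< is_zero w >] then [set: X]
  else if `[< exists v, is_succ v w >] then
    [set x | forall v (vw : olt v w), is_succ v w ->
               (D v vw `\` isolated (D v vw)) x]
  else [set x | forall v (vw : olt v w), D v vw x].

Definition derivative : W -> set X := Fix olt_wf (fun=> set X) derivative_step.

Lemma derivativeE w :
  derivative w = @derivative_step w (fun v _ => derivative v).
Proof.
rewrite /derivative Fix_eq // => {}w f g fg; congr derivative_step.
by apply: functional_extensionality_dep => v; apply/funext => vw.
Qed.

Lemma derivative_zero w : is_zero w -> derivative w = [set: X].
Proof. by move=> w0; rewrite derivativeE /derivative_step asboolT. Qed.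

Lemma derivative_succ v w : is_succ v w ->
  derivative w = derivative v `\` isolated (derivative v).
Proof.
move=> vw; rewrite derivativeE /derivative_step asboolF; last first.
  by move=> /(_ v); apply; case: vw.
rewrite asboolT; last by exists v.
apply/seteqP; split=> [x Dx|x xv u _ uw]; first exact: (Dx v (proj1 vw) vw).
by rewrite (succ_uniq uw vw).
Qed.

Lemma derivative_limit w : is_limit w ->
  derivative w = \bigcap_(v in segment w) derivative v.
Proof.
move=> [w0 wS]; rewrite derivativeE /derivative_step asboolF // asboolF //.
by case=> v /wS.
Qed.

End Ordinals.

Arguments derivative {W le} wo X w.

Lemma initial_ordinal_exists (M : Type) :
  exists (W : eqType) (le : rel W) (w : W),
    well_order le /\ is_initial_ordinal le M w.
Proof.
have [r wor] := well_ordering_principle {classic M}.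
pose le (a b : option {classic M}) :=
  match a, b with
  | Some x, Some y => r x y | _, None => true | None, Some _ => false end.
have wole : well_order le.
  apply: antisymmetric_well_order.
    move=> [x|] [y|] //= /andP[xy yx]; congr Some; exact: wo_anti wor _ _ xy yx.
  move=> A [a aA].
  have [[x xA]|nA] := pselect (exists x, Some x \in A).
    have [|z zA zmin] := wo_min wor (P := fun x => Some x \in A); first by exists x.
    by exists (Some z); split=> // -[y|] //; apply: zmin.
  exists None; split; first by case: a aA => // x xA; case: nA; exists x.
  by move=> [y|] // yA; case: nA; exists y.
have [|w wM wmin] := wo_min wole (P := fun w => segment le w #= [set: M]).
  exists None.
  have -> : segment le None = some @` [set: {classic M}].
    apply/seteqP; split=> [[x|]|_ [x _ <-]] //=; last by case.
    by move=> _; exists x.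
  exact: (@card_some {classic M} [set: {classic M}]).
exists _, le, w; split=> //; split=> // v [vw nvw] vM.
by apply: nvw; apply: wo_anti wole _ _ vw (wmin _ vM).
Qed.

Definition homeomorphic (X Y : topologicalType) : Prop :=
  exists (f : X -> Y) (g : Y -> X),
    [/\ cancel f g, cancel g f, continuous f & continuous g].

(* Main.v *)
(* The points of the spaces are the finite descending sequences of labelled
   nodes of a well-founded tree, each child being repeated infinitely often with
   an index n, where the copies of index n lie at distance 1/(n+1) from the
   parent. When the labels carry an ordinal rank such that the rank of a label is
   the least ordinal above the ranks of its children, the v-th derivative is the
   set of sequences ending in a label of rank at least v. Using the ordinals below
   m as labels gives a space of cardinality m with empty m-derivative.

   To encode a subset of m we use that a point of rank one may be of two kinds: a
   limit of a mere convergent sequence of isolated points, or a limit of isolated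
   points infinitely many of which lie at each distance (a fan, which is not
   locally compact). An ordinal a > 1 of the subset receives an extra, marked
   label of rank a having in addition a fan child. Then the subset is the set of
   ranks of the points that are limits of fans, a topological invariant. *)
From HB Require Import structures.
Require Import Defs.
Set Implicit Arguments.
Unset Strict Implicit.
Unset Printing Implicit Defensive.
Import Order.TTheory GRing.Theory Num.Theory.
Local Open Scope classical_set_scope.
Local Open Scope card_scope.

(** * Squares of infinite cardinals *)

Lemma card_le_inj (T U : Type) (A : set T) (B : set U) (f : T -> U) :
  (forall x, A x -> B (f x)) ->
  (forall x y, A x -> A y -> f x = f y -> x = y) -> A #<= B.
Proof.
move=> AB inj; have fA : f @` A #= A.
  by apply: inj_card_eq => x y; rewrite !inE; apply: inj.
by rewrite -(card_le_eql fA); apply: subset_card_le => _ [x Ax <-]; apply: AB.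
Qed.

Lemma card_le_exinj (T U : Type) (A : set T) (B : set U) (u : U) :
  A #<= B -> exists f : T -> U, (forall x, A x -> B (f x)) /\
    (forall x y, A x -> A y -> f x = f y -> x = y).
Proof.
elim/Ppointed: U => U in B u *; first by have := no u.
move=> /pcard_leP[f]; exists f; split=> [x Ax|x y Ax Ay]; first exact: funS.
by apply: inj; rewrite inE.
Qed.

Lemma card_leT_exinj (T U : Type) :
  [set: T] #<= [set: U] -> exists f : T -> U, injective f.
Proof.
have [[u _]|nU] := pselect ([set: U] !=set0).
  by move=> /(card_le_exinj u)[f [_ inj]]; exists f => x y; apply: inj.
have -> : [set: U] = set0 by apply: contrapT => /eqP/set0P.
move=> /card_le0P T0; have nT (t : T) : False by have : [set: T] t by []; rewrite T0.
by exists (fun t => False_rect _ (nT t)) => t; case: (nT t).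
Qed.

Lemma card_le_setX (T T' U U' : Type) (u : U) (u' : U') (A : set T) (A' : set T')
    (B : set U) (B' : set U') :
  A #<= B -> A' #<= B' -> A `*` A' #<= B `*` B'.
Proof.
move=> /(card_le_exinj u)[f [AB finj]] /(card_le_exinj u')[g [AB' ginj]].
apply: (@card_le_inj _ _ _ _ (fun p => (f p.1, g p.2))) => [p [pA pA']|].
  by split; [apply: AB|apply: AB'].
by move=> [a a'] [b b'] [/= Aa Aa'] [/= Ab Ab'] [/finj -> // /ginj ->].
Qed.

(* Greedy transfinite recursion: send x to any point of A not yet taken. *)
Lemma card_le_of_small_segments (T U : Type) (lt : T -> T -> Prop) (D : set T)
    (A : set U) : well_founded lt -> (forall x y, x = y \/ lt x y \/ lt y x) ->
  (forall x, D x -> ~ (A #<= [set y | D y /\ lt y x])) -> D #<= A.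
Proof.
move=> ltwf lttot small.
have [[x0 Dx0]|nD] := pselect (D !=set0); last first.
  by have -> : D = set0 by apply: contrapT => /eqP/set0P.
have [u0 _] : A !=set0.
  by apply/set0P/eqP => A0; apply: (small _ Dx0); rewrite A0 card_ge0.
(* The default [u0] is returned only when no point of [A] is free. On [D] this cannot happen: [f]
   would then cover [A] by the image of the predecessors of [x], against [small]. *)
pose step x (f : forall y, lt y x -> U) : U :=
  @xget {classic U} u0 [set a | A a /\ forall y (yx : lt y x), D y -> f y yx <> a].
pose f := Fix ltwf (fun=> U) step.
have fE x : f x = step x (fun y _ => f y).
  rewrite /f Fix_eq // => {}x g h gh; congr step.
  by apply: functional_extensionality_dep => y; apply/funext.
have fP x : D x -> A (f x) /\ forall y, lt y x -> D y -> f y <> f x.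
  move=> Dx; rewrite [f x]fE /step; case: xgetP => [a -> //|nA].
  case: (small _ Dx); apply: (@card_le_trans _ _ _ (f @` [set y | D y /\ lt y x])).
    apply: subset_card_le => a Aa; apply: contrapT => na; apply: (nA a); split=> //.
    by move=> y yx Dy ya; apply: na; exists y.
  exact: card_image_le.
apply: (@card_le_inj _ _ _ _ f) => [x /fP[]//|x y Dx Dy fxy].
case: (lttot x y) => [//|[xy|yx]].
  by case: (fP _ Dy) => _ /(_ _ xy Dx).
by case: (fP _ Dx) => _ /(_ _ yx Dy); rewrite fxy.
Qed.

Section WellOrder.
Variables (W : eqType) (le : rel W).
Hypothesis wo : well_order le.
Local Notation lt := (olt le).

Lemma wo_refl v : le v v. Proof. by case: (wo_total wo v v). Qed.

Lemma wo_trans u v w : le u v -> le v w -> le u w.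
Proof.
move=> uv vw.
have [|z zP zmin] := wo_min wo (P := fun x => [\/ x = u, x = v | x = w]).
  by exists u; constructor.
have zu : le z u by apply: zmin; constructor.
have zv : le z v by apply: zmin; constructor.
have zw : le z w by apply: zmin; constructor.
case: zP => e; subst z => //.
  by rewrite (wo_anti wo uv zu).
by rewrite -(wo_anti wo vw zv).
Qed.

Lemma wo_nolt v w : ~ lt v w -> le w v.
Proof.
move=> nvw; case: (wo_total wo v w) => // vw.
by have [->|/eqP ne] := eqVneq v w; [exact: wo_refl|case: nvw].
Qed.

Lemma wo_ltgt v w : lt v w -> le w v -> False.
Proof. by move=> [vw ne] wv; apply: ne; apply: wo_anti wv. Qed.

Lemma wo_lelt u v w : le u v -> lt v w -> lt u w.
Proof.
move=> uv vw; split; first by apply: wo_trans uv (proj1 vw).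
by move=> uw; rewrite uw in uv; apply: wo_ltgt vw uv.
Qed.

Lemma wo_ltle u v w : lt u v -> le v w -> lt u w.
Proof.
move=> uv vw; split; first by apply: wo_trans (proj1 uv) vw.
by move=> uw; rewrite -uw in vw; apply: wo_ltgt uv vw.
Qed.

Lemma wf_of_min (T : Type) (R : T -> T -> Prop) :
  (forall P : T -> Prop, (exists x, P x) ->
    exists2 x, P x & forall y, P y -> ~ R y x) ->
  well_founded R.
Proof.
move=> Rmin x; apply: contrapT => nx.
have [|z nz zmin] := Rmin (fun x => ~ Acc R x); first by exists x.
by apply: nz; constructor=> y yz; apply: contrapT => /zmin.
Qed.

(* The canonical well-order of pairs: by maximum first, then in any fixed
   well-order; every proper initial segment lies in the square of a segment. *)
Lemma card_segment_square v : infinite_set (segment le v) ->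
  segment le v `*` segment le v #<= segment le v.
Proof.
elim/(well_founded_ind (olt_wf wo)): v => v IH vinf.
(* If the segment of [v] injects into that of a smaller [u], the claim for [u] carries over.
   Otherwise [v] behaves as an initial ordinal, and the order [ltp] on pairs is used. *)
have [[u [uv vu]]|vcard] := pselect (exists u, lt u v /\ segment le v #<= segment le u).
  have uinf : infinite_set (segment le u) by move/(card_le_finite vu).
  apply: (card_le_trans (card_le_setX u u vu vu)).
  apply: (card_le_trans (IH _ uv uinf)).
  by apply: subset_card_le => x xu; apply: wo_ltle xu (proj1 uv).
pose mx (p : W * W) := if le p.1 p.2 then p.2 else p.1.
have mxl p : le p.1 (mx p) by rewrite /mx; case: ifP => // _; apply: wo_refl.
have mxr p : le p.2 (mx p).
  rewrite /mx; case: ifP => [_|]; first exact: wo_refl.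
  by case: (wo_total wo p.1 p.2) => ->.
have [r wor] := well_ordering_principle {classic (W * W)}.
pose ltp (p q : W * W) := lt (mx p) (mx q) \/ mx p = mx q /\ olt r p q.
apply: (@card_le_of_small_segments _ _ ltp).
- apply: wf_of_min => P [p0 Pp0].
  have [|_ [p Pp <-] pmin] := wo_min wo (P := fun x => exists2 p, P p & mx p = x).
    by exists (mx p0), p0.
  have [|q [Pq qp] qmin] := wo_min wor (P := fun q => P q /\ mx q = mx p).
    by exists p.
  exists q => // s Ps [sq|[sq [sq1 sq2]]].
    by apply: wo_ltgt sq _; rewrite qp; apply: pmin; exists s.
  by apply/sq2/(wo_anti wor sq1)/qmin; rewrite -qp.
- move=> p q.
  have [e|/eqP ne] := eqVneq (mx p) (mx q); last first.
    right; case: (wo_total wo (mx p) (mx q)) => h; [left|right]; left; split=> //.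
    exact/nesym.
  have [e'|/eqP ne] := eqVneq (p : {classic (W * W)}) q; first by left.
  right; case: (wo_total wor p q) => h; [left|right]; right; split=> //; split=> //.
  exact/nesym.
move=> p [p1v p2v]; set c := mx p.
have cv : lt c v by rewrite /c /mx; case: ifP.
have sub : [set q | (segment le v `*` segment le v) q /\ ltp q p] `<=`
    (c |` segment le c) `*` (c |` segment le c).
  move=> q [_ qp]; have {qp} qc : le (mx q) c.
    by case: qp => [[]//|[-> _]]; apply: wo_refl.
  by split=> /=; [set x := q.1|set x := q.2];
    (have [->|/eqP ne] := eqVneq x c; [left|right; split=> //;
      apply: wo_trans qc; rewrite /x]).
move=> /card_le_trans/(_ (subset_card_le sub)) vle.
have [cfin|cinf] := pselect (finite_set (segment le c)).
  by apply/vinf/(card_le_finite vle)/finite_setX; rewrite finite_setU.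
apply: vcard; exists c; split=> //; apply: (card_le_trans vle).
have cc := IH _ cv cinf.
(* Adjoining [c] does not enlarge the infinite segment: inside its square, [c] is coded as
   [(z1, z0)] and any other [x] as [(z0, x)], with [z0] and [z1] distinct. *)
have [z0 z0c] := infinite_setN0 cinf.
have [z1 [z1c z10]] := infinite_setN0 (infinite_setD cinf (finite_set1 z0)).
have c1 : c |` segment le c #<= segment le c.
  apply: card_le_trans cc.
  apply: (@card_le_inj _ _ _ _ (fun x => if x == c then (z1, z0) else (z0, x))).
    by move=> x /=; case: eqVneq => [_ _|/eqP nxc [//|xc]].
  move=> x y _ _; case: eqVneq => [->|_]; case: eqVneq => [->|_] //.
  - by case=> /z10.
  - by case=> /esym/z10.
  - by case.
exact: card_le_trans (card_le_setX c c c1 c1) cc.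
Qed.

End WellOrder.

(** * Homeomorphism invariants *)

Section Homeomorphism.
Variables (X Y : topologicalType) (f : X -> Y) (g : Y -> X).
Hypotheses (fK : cancel f g) (gK : cancel g f).
Hypotheses (cf : continuous f) (cg : continuous g).

Lemma homeo_nbhs y (U : set X) : nbhs y (g @^-1` U) <-> nbhs (g y) U.
Proof.
split=> [yU|]; last exact: cg.
have -> : U = f @^-1` (g @^-1` U) by apply/seteqP; split=> x /=; rewrite fK.
by apply: cf; rewrite gK.
Qed.

Lemma homeo_preimage (U : set Y) : U = g @^-1` (f @^-1` U).
Proof. by apply/seteqP; split=> x /=; rewrite gK. Qed.

Lemma homeo_isolated (A : set X) : isolated (g @^-1` A) = g @^-1` isolated A.
Proof.
apply/seteqP; split=> y [/set_mem Ay [U yU UA]]; (split; first exact/mem_set).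
- exists (f @^-1` U).
    by apply/homeo_nbhs; rewrite -homeo_preimage.
  apply/seteqP; split=> [x [Ux Ax]|x ->].
    have : (U `&` g @^-1` A) (f x) by split=> //=; rewrite fK.
    by rewrite UA => <-; rewrite fK.
  have [Uy _] : (U `&` g @^-1` A) y by rewrite UA.
  by split=> //=; rewrite gK.
- exists (g @^-1` U); first exact/homeo_nbhs.
  apply/seteqP; split=> [x [Ux Ax]|x ->].
    have : (U `&` A) (g x) by [].
    by rewrite UA => xy; rewrite /= -(gK x) xy gK.
  by have : (U `&` A) (g y) by rewrite UA.
Qed.

Lemma homeo_limit_point (A : set X) :
  limit_point (g @^-1` A) = g @^-1` limit_point A.
Proof.
apply/seteqP; split=> y yA U.
- move=> /homeo_nbhs/yA[z [zy Az Uz]]; exists (g z); split=> //.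
  by apply: contra_neq zy => /(can_inj gK).
- rewrite [U]homeo_preimage => /homeo_nbhs/yA[z [zy Az Uz]].
  by exists (f z); rewrite /= fK; split=> //; apply: contra_neq zy => <-.
Qed.

Lemma homeo_derivative (W : eqType) (le : rel W) (wo : well_order le) v :
  derivative wo Y v = g @^-1` derivative wo X v.
Proof.
elim/(well_founded_ind (olt_wf wo)): v => v IH.
have [v0|nv0] := pselect (is_zero le v).
  by rewrite !derivative_zero.
have [[u uv]|nvS] := pselect (exists u, is_succ le u v).
  rewrite !(derivative_succ wo _ uv) IH; last by case: uv.
  by rewrite homeo_isolated.
have vl : is_limit le v by split=> // u uv; apply: nvS; exists u.
rewrite !(derivative_limit wo _ vl) preimage_bigcap.
exact: eq_bigcapr.
Qed.

End Homeomorphism.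

(** In a Hausdorff space this says that [x] is isolated or that near [x] the space is just a
    sequence-like set of points converging to [x]. It separates mere convergent sequences from
    fans. *)
Definition tame (X : topologicalType) (x : X) : Prop :=
  exists2 U : set X, nbhs x U & forall V, nbhs x V -> finite_set (U `\` V).

Lemma homeo_tame (X Y : topologicalType) (f : X -> Y) (g : Y -> X) :
  cancel f g -> cancel g f -> continuous f -> continuous g ->
  @tame Y = g @^-1` @tame X.
Proof.
suff H (X' Y' : topologicalType) (f' : X' -> Y') (g' : Y' -> X') x :
    cancel f' g' -> cancel g' f' -> continuous f' -> continuous g' ->
    tame x -> tame (f' x).
  move=> fK gK cf cg; apply/seteqP; split=> y; first exact: H fK cg cf.
  by move=> /(H _ _ _ _ _ fK gK cf cg); rewrite gK.
move=> fK gK cf cg [U xU Ufin]; exists (g' @^-1` U).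
  by apply/(homeo_nbhs fK gK cf cg); rewrite fK.
move=> V xV; have /Ufin/(finite_image f') : nbhs x (f' @^-1` V) by exact: cf.
apply: sub_finite_set => y [Uy Vy]; exists (g' y); rewrite ?gK //.
by split=> //=; rewrite gK.
Qed.

(** The isolated points of the [v]-th derivative are those of rank exactly [v]. With [u] the ordinal
    one, these are the points of rank [v] that are limits of fans, described in purely topological
    terms. *)
Definition wild_limits (W : eqType) (le : rel W) (wo : well_order le)
    (X : topologicalType) (u v : W) : set X :=
  limit_point (isolated (derivative wo X u) `\` @tame X) `&`
  isolated (derivative wo X v).
Arguments wild_limits {W le} wo X u v.

Lemma homeomorphic_wild_limits (W : eqType) (le : rel W) (wo : well_order le)
    (X Y : topologicalType) (u v : W) : homeomorphic X Y ->
  wild_limits wo X u v !=set0 <-> wild_limits wo Y u v !=set0.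
Proof.
move=> [f [g [fK gK cf cg]]].
have -> : wild_limits wo Y u v = g @^-1` wild_limits wo X u v.
  rewrite /wild_limits !(homeo_derivative fK gK cf cg) (homeo_tame fK gK cf cg).
  rewrite !(homeo_isolated fK gK cf cg) preimage_setI.
  by rewrite -(homeo_limit_point fK gK cf cg (_ `\` _)).
by split=> [[x xP]|[y yP]]; [exists (f x); rewrite /= fK|exists (g y)].
Qed.

(** * Metric spaces of descending sequences *)

Section SequenceDistance.
Local Open Scope ring_scope.
Variables (R : realType) (T : choiceType).
Local Notation entry := (T * nat)%type.
Implicit Types s t u : seq entry.

Definition entry_weight (x : entry) : R := x.2.+1%:R^-1.

Fixpoint seq_weight s : R :=
  if s is x :: s' then Num.max (entry_weight x) (seq_weight s') else 0.

(** The largest weight of an entry left in either sequence once the longest common prefix is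
    removed; this is an ultrametric. *)
Fixpoint seq_dist s t : R :=
  match s, t with
  | x :: s', y :: t' =>
      if x == y then seq_dist s' t' else Num.max (seq_weight s) (seq_weight t)
  | [::], _ => seq_weight t
  | _, [::] => seq_weight s
  end.

Lemma entry_weight_gt0 x : 0 < entry_weight x.
Proof. by rewrite invr_gt0. Qed.

Lemma seq_weight_ge0 s : 0 <= seq_weight s.
Proof. by elim: s => //= x s IH; rewrite le_max IH orbT. Qed.

Lemma seq_weight_cons_gt0 x s : 0 < seq_weight (x :: s).
Proof. by rewrite /= lt_max entry_weight_gt0. Qed.

Lemma seq_dist0s t : seq_dist [::] t = seq_weight t.
Proof. by case: t. Qed.

Lemma seq_dists0 t : seq_dist t [::] = seq_weight t.
Proof. by case: t. Qed.

Lemma seq_dist_ge0 s t : 0 <= seq_dist s t.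
Proof.
elim: s t => [|x s IH] [|y t] //; try exact: (seq_weight_ge0 (_ :: _)).
rewrite /=; case: eqP => // _; rewrite le_max.
by rewrite (seq_weight_ge0 (x :: s)).
Qed.

Lemma seq_distxx s : seq_dist s s = 0.
Proof. by elim: s => //= x s IH; rewrite eqxx. Qed.

Lemma seq_dist_eq0 s t : seq_dist s t = 0 -> s = t.
Proof.
elim: s t => [|x s IH] [|y t] //.
- by move=> e; have := seq_weight_cons_gt0 y t; rewrite -e /= ltxx.
- by move=> e; have := seq_weight_cons_gt0 x s; rewrite -e /= ltxx.
rewrite /=; case: eqP => [-> /IH -> //|_ e].
by have := seq_weight_cons_gt0 x s; rewrite ltNge -{1}e le_max lexx.
Qed.

Lemma seq_dist_sym s t : seq_dist s t = seq_dist t s.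
Proof.
by elim: s t => [|x s IH] [|y t] //=; rewrite eq_sym IH maxC.
Qed.

(** The weight is the distance to the empty sequence, so this lemma and the next are the ultrametric
    inequality with an outer, respectively the middle, point empty. The general case reduces to them
    where the common prefixes end. *)
Lemma seq_weight_le_dist r s t :
  seq_dist s t <= r -> seq_weight t <= r -> seq_weight s <= r.
Proof.
elim: s t => [|x s IH] [|y t] //=.
  by move=> _; apply: le_trans; rewrite le_max seq_weight_ge0 orbT.
case: eqP => [->|_]; last by rewrite ge_max => /andP[].
by move=> st; rewrite !ge_max => /andP[-> /(IH _ st)].
Qed.

Lemma seq_dist_le_weight r s t :
  seq_weight s <= r -> seq_weight t <= r -> seq_dist s t <= r.
Proof.
elim: s t => [|x s IH] [|y t] //=.
case: eqP => [->|_]; last by rewrite !ge_max => -> ->.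
by rewrite !ge_max => /andP[_ sr] /andP[_ tr]; apply: IH.
Qed.

Lemma seq_dist_ultra r s t u :
  seq_dist s t <= r -> seq_dist t u <= r -> seq_dist s u <= r.
Proof.
elim: t s u => [|y t IH] [|x s] [|z u]; rewrite ?seq_dist0s ?seq_dists0 //.
- exact: seq_dist_le_weight.
- by move=> yr _; apply: le_trans yr; apply: seq_weight_ge0.
- by move=> yr; rewrite seq_dist_sym => /seq_weight_le_dist; apply.
- exact: seq_weight_le_dist.
rewrite /=; case: (eqVneq x y) => [->|xy].
  case: (eqVneq y z) => [_|yz]; first exact: IH.
  by rewrite !ge_max => /seq_weight_le_dist sr /andP[/andP[-> /sr ->] ->].
case: (eqVneq y z) => [<-|yz].
  rewrite (negbTE xy) !ge_max => /andP[-> /andP[-> tr]].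
  by rewrite seq_dist_sym => /seq_weight_le_dist; apply.
rewrite !ge_max => /andP[/andP[xr sr] _] /andP[_ /andP[zr ur]].
case: eqP => _; first exact: seq_dist_le_weight.
by rewrite !ge_max xr sr zr.
Qed.

Lemma seq_dist_triangle t s u : seq_dist s u <= seq_dist s t + seq_dist t u.
Proof.
by apply: (@seq_dist_ultra _ _ t); rewrite ?lerDl ?lerDr seq_dist_ge0.
Qed.

Lemma seq_dist_cat s u : seq_dist s (s ++ u) = seq_weight u.
Proof. by elim: s => [|x s IH] /=; rewrite ?seq_dist0s ?eqxx. Qed.

Lemma seq_weight_lt_all N s :
  seq_weight s < N.+1%:R^-1 -> all (fun x => N <= x.2)%N s.
Proof.
elim: s => //= x s IH; rewrite gt_max => /andP[+ /IH ->]; rewrite andbT.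
by rewrite ltf_pV2 ?posrE // ltr_nat ltnS => /ltnW.
Qed.

Lemma seq_weight_all_lt N s (r : R) : N.+1%:R^-1 < r ->
  all (fun x => N <= x.2)%N s -> seq_weight s < r.
Proof.
move=> Nr; elim: s => /= [_|x s IH /andP[Nx /IH sr]].
  by apply: lt_trans Nr; rewrite invr_gt0.
rewrite gt_max sr andbT; apply: le_lt_trans Nr.
by rewrite lef_pV2 ?posrE // ler_nat.
Qed.

Lemma seq_dist_small s N : exists2 r : R, 0 < r &
  forall t, seq_dist s t < r ->
    exists2 u, t = s ++ u & all (fun x => N <= x.2)%N u.
Proof.
elim: s => [|x s [r r0 IH]].
  exists N.+1%:R^-1; first by rewrite invr_gt0.
  by move=> t; rewrite seq_dist0s => /seq_weight_lt_all Nt; exists t.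
exists (Num.min r (entry_weight x)); first by rewrite lt_min r0 entry_weight_gt0.
move=> [|y t] /=; first by rewrite gt_max lt_min ltxx andbF.
case: eqP => [<-|_]; last by rewrite !gt_max lt_min ltxx andbF.
by rewrite lt_min => /andP[/IH[u -> Nu] _]; exists u.
Qed.

End SequenceDistance.

(** * The space of descending sequences of a tree, and its neighbourhoods *)

Section TreeSpace.
Local Open Scope ring_scope.
Variables (R : realType) (T : Type) (child : T -> T -> Prop).
Local Notation entry := ({classic T} * nat)%type.

Definition child_entry (x y : entry) : bool := `[< child x.1 y.1 >].

(* Nonempty child-descending sequences, split as (first entry, rest); K only
   records the field in which distances are measured. *)
Definition tree_space (K : realType) : Type :=
  {p : entry * seq entry | path child_entry p.1 p.2}.

Local Notation X := (tree_space R).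

HB.instance Definition _ := Choice.on X.

Definition tree_seq (x : X) : seq entry := (val x).1 :: (val x).2.

Lemma tree_seq_inj : injective tree_seq.
Proof. by move=> [[x s] xs] [[y t] yt] [/= xy st]; apply/val_inj; rewrite /= xy st. Qed.

Definition tree_dist (x y : X) : R := seq_dist R (tree_seq x) (tree_seq y).

HB.instance Definition _ := @isMetric.Build R X tree_dist
  (fun x => seq_distxx R (tree_seq x))
  (fun x y xy => tree_seq_inj (seq_dist_eq0 xy))
  (fun x y => seq_dist_sym R (tree_seq x) (tree_seq y))
  (fun y x z => seq_dist_triangle R (tree_seq y) (tree_seq x) (tree_seq z)).

Definition label (x : X) : T := (last (val x).1 (val x).2).1.

(** The metric enters the later arguments only through this neighbourhood base. *)
Lemma tree_nbhsP (x : X) (U : set X) : nbhs x U <->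
  exists N, forall (y : X) u, tree_seq y = tree_seq x ++ u ->
    all (fun e => N <= e.2)%N u -> U y.
Proof.
split=> [/nbhs_ballP[e /= e0 eU]|[N NU]].
  exists (Num.bound e^-1) => y u yxu Nu; apply: eU.
  rewrite ballEmdist /= /mdist /= /tree_dist yxu seq_dist_cat.
  apply: seq_weight_all_lt Nu; rewrite invf_plt ?posrE //.
  apply: lt_trans (archi_boundP _) _; first by rewrite invr_ge0 ltW.
  by rewrite ltr_nat.
have [r r0 rN] := seq_dist_small R (tree_seq x) N.
apply/nbhs_ballP; exists r => //= y; rewrite ballEmdist /= => /rN[u yxu Nu].
exact: NU yxu Nu.
Qed.

Lemma path_last_ind (Q : T -> Prop) (e : entry) (u : seq entry) :
  (forall a b, a = e.1 \/ Q a -> child a b -> Q b) ->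
  path child_entry e u -> u <> [::] -> Q (last e u).1.
Proof.
move=> Qstep; elim/last_ind: u => // u z IH; rewrite rcons_path last_rcons.
move=> /andP[eu /asboolP uz] _; apply: Qstep uz.
by case: u => [|c u] in IH eu *; [left|right; apply: IH].
Qed.

(** Induction along the added entries; [Q] may fail at the label of [x] itself, as it concerns
    proper extensions only. *)
Lemma label_ext (Q : T -> Prop) (x y : X) u :
  (forall a b, a = label x \/ Q a -> child a b -> Q b) ->
  tree_seq y = tree_seq x ++ u -> y <> x -> Q (label y).
Proof.
move=> Qstep yxu yx; have u0 : u <> [::].
  by move=> u0; apply/yx/tree_seq_inj; rewrite yxu u0 cats0.
move: yxu Qstep; rewrite /label; case: x y {yx} => [[x s] xs] [[y t] yt] /=.
case=> yx tsu Qstep; move: yt; rewrite /= yx tsu cat_path last_cat.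
by move=> /andP[_ /path_last_ind]; apply.
Qed.

Lemma tree_child (x : X) b n : child (label x) b ->
  exists2 y : X, tree_seq y = tree_seq x ++ [:: (b, n)] & label y = b.
Proof.
case: x => [[x s] xs]; rewrite /label /= => xb.
have p : path child_entry x (rcons s (b : {classic T}, n)).
  by rewrite rcons_path xs; apply/asboolP.
exists (exist _ (x, rcons s (b : {classic T}, n)) p); rewrite /= ?last_rcons //.
by rewrite /tree_seq /= cats1.
Qed.

(** * Derivatives computed from ranks *)

Section Rank.
Variables (W : eqType) (le : rel W) (wo : well_order le) (rank : T -> W).
Hypothesis rank_child : forall a b, child a b -> olt le (rank b) (rank a).
Hypothesis child_rank : forall a v,
  olt le v (rank a) -> exists2 b, child a b & le v (rank b).

Lemma rank_ext (x y : X) u : tree_seq y = tree_seq x ++ u -> y <> x ->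
  olt le (rank (label y)) (rank (label x)).
Proof.
move=> yxu; apply: (label_ext (Q := fun b => olt le (rank b) (rank (label x)))) yxu.
move=> a b ax /rank_child ba; case: ax => [<- //|ax].
by apply: (wo_ltle wo) ba _; case: ax.
Qed.

(** A point of rank above [v] has a child of rank at least [v], whose copies of large index come
    arbitrarily close. Around a point of rank [v], its extensions form a neighbourhood in which all
    other points have smaller rank. *)
Lemma isolated_rank v :
  isolated [set x : X | le v (rank (label x))] = [set x : X | rank (label x) = v].
Proof.
apply/seteqP; split=> x.
- case=> /set_mem vx [U xU Ueq]; apply: contrapT => xv.
  have /child_rank[b xb vb] : olt le v (rank (label x)) by split=> // /esym.
  have [N NU] := (tree_nbhsP x U).1 xU.
  have [y yx yb] := tree_child N xb.
  have : (U `&` [set x : X | le v (rank (label x))]) y.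
    by split; [apply: NU yx _; rewrite /= leqnn|rewrite /= yb].
  rewrite Ueq => e; move/(congr1 size): yx; rewrite e size_cat /= addn1.
  by move/n_Sn.
- move=> xv; split; first by apply/mem_set; rewrite /= xv; apply: wo_refl.
  exists [set y | exists u, tree_seq y = tree_seq x ++ u].
    by apply/tree_nbhsP; exists 0%N => y u yxu _; exists u.
  apply/seteqP; split=> [y [[u yxu] vy]|_ ->]; last first.
    by split; [exists [::]; rewrite cats0|rewrite /= xv; apply: wo_refl].
  apply: contrapT => /(rank_ext yxu); rewrite xv => yv.
  exact: wo_ltgt yv vy.
Qed.

Lemma derivative_rank v : derivative wo X v = [set x : X | le v (rank (label x))].
Proof.
elim/(well_founded_ind (olt_wf wo)): v => v IH.
have [v0|nv0] := pselect (is_zero le v).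
  by rewrite derivative_zero //; apply/seteqP; split=> x // _; apply: wo_nolt.
have [[u uv]|nvS] := pselect (exists u, is_succ le u v).
  case: (uv) => ultv umax; rewrite (derivative_succ wo _ uv) IH // isolated_rank.
  apply/seteqP; split=> x /= => [[ux xu]|vx].
    by apply: (wo_nolt wo) => xv; apply: xu; apply: (wo_anti wo) ux; apply: umax.
  split; first by apply: (wo_trans wo) vx; case: ultv.
  by move=> xu; apply: (wo_ltgt wo ultv); rewrite -xu.
have vl : is_limit le v by split=> // u uv; apply: nvS; exists u.
rewrite (derivative_limit wo _ vl); apply/seteqP; split=> x /= => [xv|vx u uv].
  (* If the rank of [x] were below [v] while bounding every [u] below [v], then [v] would be its
     successor, hence no limit. *)
  apply: (wo_nolt wo) => xltv; apply: nvS; exists (rank (label x)); split=> // u uv.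
  by have := xv u uv; rewrite IH.
by rewrite IH //=; apply: (wo_trans wo) vx; case: uv.
Qed.

End Rank.

End TreeSpace.

(** * Encoding a subset *)

Section TreeTame.
Variables (R : realType) (T : Type) (child : T -> T -> Prop).
Local Notation X := (tree_space child R).

Lemma tree_cat_path (x y : X) u : tree_seq y = tree_seq x ++ u ->
  path (child_entry child) (last (val x).1 (val x).2) u.
Proof.
case: x y => [[x s] xs] [[y t] yt] /= [yx ts]; move: yt.
by rewrite /= yx ts cat_path => /andP[].
Qed.

(** The proper extensions of [x] are just the copies of the childless [c], and a neighbourhood of
    [x] misses only those of index below some [N]. *)
Lemma tree_tame (x : X) c :
  (forall b, child (label x) b -> b = c) -> (forall b, ~ child c b) -> tame x.
Proof.
move=> xc nc; exists [set y | exists u, tree_seq y = tree_seq x ++ u].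
  by apply/tree_nbhsP; exists 0%N => y u yxu _; exists u.
move=> V /tree_nbhsP[N NV].
pose one_step n := tree_seq x ++ [:: (c : {classic T}, n)].
apply: (@sub_finite_set _ _ (@tree_seq _ _ _ @^-1` (one_step @` `I_N))).
  move=> y [[u yxu] nVy]; have := tree_cat_path yxu.
  case: u yxu => [|[b n] u] yxu; first by case: nVy; apply: NV yxu _.
  move=> /= /andP[/asboolP /= /xc bc]; subst b.
  case: u yxu => [|d u] yxu /=; last by move=> /andP[/asboolP /= /nc].
  move=> _; exists n => //=; rewrite ltnNge; apply/negP => Nn; apply: nVy.
  by apply: NV yxu _; rewrite /= Nn.
apply: finite_preimage; last exact/finite_image/finite_II.
by move=> y z _ _; apply: tree_seq_inj.
Qed.

(** Any neighbourhood of [x] contains, for some [N], the copies of index [N] of all the [c i]; these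
    infinitely many points lie outside the neighbourhood given by indices above [N]. *)
Lemma tree_not_tame (x : X) (c : nat -> T) :
  injective c -> (forall i, child (label x) (c i)) -> ~ tame x.
Proof.
move=> cinj xc [U /tree_nbhsP[N NU]].
have /choice[y yP] : forall i, exists y : X,
    tree_seq y = tree_seq x ++ [:: (c i : {classic T}, N)].
  by move=> i; have [y yx _] := tree_child N (xc i); exists y.
have xV : nbhs x [set z : X | exists2 u, tree_seq z = tree_seq x ++ u &
                                         all (fun e => N < e.2)%N u].
  by apply/tree_nbhsP; exists N.+1 => z u zxu Nu; exists u.
move=> /(_ _ xV); apply/infiniteP; apply: (@card_le_inj _ _ _ _ y) => [i _|i j _ _ yij].
  split; first by apply: NU (yP i) _; rewrite /= leqnn.
  case=> u; rewrite yP => /eqP; rewrite eqseq_cat // => /andP[_ /eqP <-].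
  by rewrite /= ltnn.
apply: cinj; move: (yP i); rewrite yij yP => /eqP.
by rewrite eqseq_cat // => /andP[_ /eqP[]].
Qed.

End TreeTame.

Inductive tree_label (M : Type) : Type :=
  Plain (a : M) | Marked (a : M) | Fan | Leaf (i : nat).
Arguments Fan {M}.
Arguments Leaf {M}.

Section LabelledTree.
Variables (R : realType) (M : Type) (W : eqType) (le : rel W).
Hypothesis wo : well_order le.
Variables (phi : M -> W) (zero one : W).
Hypotheses (phi_inj : injective phi).
Hypothesis phi_segment : forall v a, olt le v (phi a) -> exists c, phi c = v.
Hypotheses (zeroP : is_zero le zero) (oneP : is_succ le zero one).
Variable S : set M.
Hypothesis S_gt1 : forall a, S a -> olt le one (phi a).

(** For [a] outside [S], [Marked a] has the same children as [Plain a], so the type of labels is the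
    same for all [S]. Marked labels are never children, and a fan is a child of marked labels
    only. *)
Definition label_child (x y : tree_label M) : Prop :=
  match x, y with
  | Plain a, Plain c | Marked a, Plain c => olt le (phi c) (phi a)
  | Marked a, Fan => S a
  | Fan, Leaf _ => True
  | _, _ => False
  end.

Definition label_rank (x : tree_label M) : W :=
  match x with Plain a | Marked a => phi a | Fan => one | Leaf _ => zero end.

Local Notation X := (tree_space label_child R).

Lemma lt_one v : olt le v one -> v = zero.
Proof.
case: oneP => _ omin /omin vz; apply: (wo_anti wo) vz _.
exact: (wo_nolt wo (@zeroP v)).
Qed.

Lemma label_rank_child a b :
  label_child a b -> olt le (label_rank b) (label_rank a).
Proof.
case: a b => [a|a||i] [c|c||j] //=; first exact: S_gt1.
by case: oneP.
Qed.

Lemma label_child_rank a v : olt le v (label_rank a) ->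
  exists2 b, label_child a b & le v (label_rank b).
Proof.
case: a => [a|a||i] /= va.
- have [c cv] := phi_segment va.
  by exists (Plain c); rewrite /= cv //; apply: wo_refl.
- have [c cv] := phi_segment va.
  by exists (Plain c); rewrite /= cv //; apply: wo_refl.
- by exists (Leaf 0); rewrite //= (lt_one va); apply: wo_refl.
- by case: (zeroP va).
Qed.

Lemma label_derivative v :
  derivative wo X v = [set x : X | le v (label_rank (label x))].
Proof. exact: (derivative_rank R wo label_rank_child label_child_rank). Qed.

Lemma label_isolated v :
  isolated (derivative wo X v) = [set x : X | label_rank (label x) = v].
Proof.
by rewrite label_derivative (isolated_rank R wo label_rank_child label_child_rank).
Qed.

(** If [phi a] is [one], then [a] is not in [S], and both [Plain a] and [Marked a] have a single
    child, the plain label of rank zero; such points are tame. A fan has infinitely many leaves as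
    children. *)
Lemma label_fan :
  isolated (derivative wo X one) `\` @tame X = [set x : X | label x = Fan].
Proof.
have tame1 (x : X) a : phi a = one ->
    (forall b, label_child (label x) b ->
      exists2 c, b = Plain c & olt le (phi c) (phi a)) ->
    tame x.
  move=> a1 xa; have [c c0] : exists c, phi c = zero.
    by apply: (@phi_segment _ a); rewrite a1; case: oneP.
  apply: (@tree_tame _ _ _ _ (Plain c)) => [b /xa[d -> ]|[d|d||i] //=].
    by rewrite a1 => /lt_one; rewrite -c0 => /phi_inj ->.
  by rewrite c0 => /zeroP.
rewrite label_isolated; apply/seteqP; split=> x /=; last first.
  move=> xF; split; first by rewrite xF.
  apply: (@tree_not_tame _ _ _ _ (@Leaf M)) => [i j [] //|i].
  by rewrite xF.
case=> xr; have := tame1 x; case: (label x) xr => [a|a||i] //= a1 tx nt.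
- by case: nt; apply: (tx a) => // -[c|c||i] //= ca; exists c.
- case: nt; apply: (tx a) => // -[c|c||i] //= => [ca|/S_gt1]; first by exists c.
  by rewrite a1 => -[].
- by case: oneP => -[_] /(_ a1).
Qed.

Lemma label_marked :
  limit_point (isolated (derivative wo X one) `\` @tame X) =
  [set x : X | exists2 a, S a & label x = Marked a].
Proof.
rewrite label_fan; apply/seteqP; split=> x /=.
  move=> /(_ [set y | exists u, tree_seq y = tree_seq x ++ u])[|y [/eqP yx yF [u yu]]].
    by apply/tree_nbhsP; exists 0%N => y u yxu _; exists u.
  apply: contrapT => xM.
  (* [Q] holds for every label that can occur properly below [label x] when the latter is not marked
     by an element of [S], and it excludes [Fan]. *)
  pose Q (b : tree_label M) := match b, label x with
    | Plain _, _ => True | Leaf _, Fan => True | _, _ => False end.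
  suff : Q (label y) by rewrite yF.
  apply: (label_ext (Q := Q)) yu yx => a b; rewrite /Q.
  case: (label x) xM => [c|c||i] xM; case: a b => [a|a||j] [b|b||k] //=;
    try (by case); try (by case=> [[]|]).
  by move=> [[->]|//] Sc; apply: xM; exists c.
case=> a Sa xa U /tree_nbhsP[N NU].
have [y yx yF] : exists2 y : X, tree_seq y =
    tree_seq x ++ [:: (Fan : {classic tree_label M}, N)] & label y = Fan.
  by apply: tree_child; rewrite xa.
exists y; split=> //; last by apply: NU yx _; rewrite /= leqnn.
by apply/eqP => e; move: yF; rewrite e xa.
Qed.

Definition single_point (l : tree_label M) : X :=
  exist _ ((l : {classic tree_label M}, 0), [::]) isT.

Lemma label_recover a : S a <-> wild_limits wo X one (phi a) !=set0.
Proof.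
rewrite /wild_limits label_marked label_isolated.
split=> [Sa|[x [[c Sc /= ->] /= /phi_inj <- //]]].
by exists (single_point (Marked a)); split=> //; exists a.
Qed.

(** Labels, entries and finite sequences are coded in turn by the pairing [p], with values of [n] as
    tags; conversely the one-entry sequences of plain labels are a copy of [M]. *)
Lemma label_tree_card (p : M * M -> M) (n : nat -> M) :
  injective p -> injective n -> [set: X] #= [set: M].
Proof.
move=> pinj ninj; rewrite card_eq_le; apply/andP; split; last first.
  apply: (@card_le_inj _ _ _ _ (fun a => single_point (Plain a))) => // a b _ _.
  by case.
pose lcode (l : tree_label M) := match l with
  | Plain a => p (n 0, a) | Marked a => p (n 1, a)
  | Fan => p (n 2, n 0) | Leaf i => p (n 3, n i) end.
have lcode_inj : injective lcode.
  move=> [a|a||i] [b|b||j] //= /pinj []; try by move=> /ninj.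
  - by move=> ->.
  - by move=> ->.
  - by move=> /ninj ->.
pose ecode (e : {classic tree_label M} * nat) := p (lcode e.1, n e.2).
have ecode_inj : injective ecode.
  by move=> [l i] [m j] /pinj[/lcode_inj <- /ninj <-].
pose fix scode (s : seq ({classic tree_label M} * nat)) : M :=
  if s is e :: s' then p (n 1, p (ecode e, scode s')) else p (n 0, n 0).
have scode_inj : injective scode.
  elim=> [|e s IH] [|f t] //= /pinj[]; try by move=> /ninj.
  by move=> /pinj[/ecode_inj <- /IH <-].
apply: (@card_le_inj _ _ _ _ (fun x => scode (tree_seq x))) => // x y _ _.
by move=> /scode_inj/tree_seq_inj.
Qed.

End LabelledTree.

(** The rows of the pairing, one for each [n i], are disjoint. A finite [B] cannot meet all of them,
    and a row that it misses is the desired copy of [M]. *)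
Lemma inj_avoid (M : Type) (p : M * M -> M) (n : nat -> M) (B : set M) :
  injective p -> injective n -> finite_set B ->
  exists2 j : M -> M, injective j & forall a, ~ B (j a).
Proof.
move=> pinj ninj Bfin.
have [[i iP]|nB] := pselect (exists i, forall a, ~ B (p (n i, a))).
  by exists (fun a => p (n i, a)) => // a b /pinj[].
have /choice[a aB] : forall i, exists a, B (p (n i, a)).
  move=> i; apply: contrapT => na; apply: nB; exists i => a Ba.
  by apply: na; exists a.
suff /infiniteP/(_ Bfin) : [set: nat] #<= B by [].
apply: (@card_le_inj _ _ _ _ (fun i => p (n i, a i))) => // i j _ _.
by move=> /pinj[/ninj].
Qed.

(* The cardinal m is that of the type M; as an ordinal it is w. *)
Theorem theorem20 (R : realType) (M : Type) (infM : infinite_set [set: M])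
    (W : eqType) (le : rel W) (wo : well_order le) (w : W)
    (wM : is_initial_ordinal le M w) :
  exists X : set M -> metricType R,
    [/\ forall A : set M, [set: X A] #= [set: M],
        forall A : set M, derivative wo (X A) w = set0
      & forall A B : set M, A <> B -> ~ homeomorphic (X A) (X B)].
Proof.
case: wM => wM _.
have winf : infinite_set (segment le w) by rewrite (eq_finite_set wM).
have [p pinj] : exists p : M * M -> M, injective p.
  apply: card_leT_exinj; rewrite -(card_le_eqr wM).
  apply: card_le_trans (card_segment_square wo winf).
  have Mw : [set: M] #<= segment le w by rewrite (card_le_eqr wM).
  apply: (card_le_trans _ (card_le_setX w w Mw Mw)).
  exact: subset_card_le.
have [n ninj] : exists n : nat -> M, injective n.
  exact/card_leT_exinj/infiniteP.
(* [phi] identifies [M] with the ordinals below [w]. *)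
have [phi [phi_inj phiw wphi]] : exists phi : M -> W,
    [/\ injective phi, forall a, olt le (phi a) w &
        forall v, olt le v w -> exists a, phi a = v].
  have /card_bijP[f [g fK gK]] : [set: M] #= segment le w by rewrite card_eq_sym.
  exists (fun a => val (f (to_setT a))); split=> [a b|a|v vw].
  - by move=> /val_inj/(can_inj fK)/(congr1 val).
  - exact: (set_mem (valP (f (to_setT a)))).
  - have vs : v \in segment le w by exact: mem_set.
    exists (val (g (SigSub vs))).
    have -> : to_setT (val (g (SigSub vs))) = g (SigSub vs) by exact: val_inj.
    by rewrite gK.
have [zero _ zmin] := wo_min wo (P := fun=> True) (ex_intro _ w I).
have zeroP : is_zero le zero by move=> v /(wo_ltgt wo); apply; apply: zmin.
have [one z1 omin] : exists2 one, one <> zero & forall v, v <> zero -> le one v.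
  apply: (wo_min wo); exists w => w0; apply: winf; rewrite w0.
  have -> : segment le zero = set0 by apply/seteqP; split=> v // /zeroP.
  exact: finite_set0.
have oneP : is_succ le zero one.
  split=> [|u u1]; first by split; [exact: zmin|exact/nesym].
  by have [->|/eqP/omin/(wo_ltgt wo u1)//] := eqVneq u zero; apply: wo_refl.
(* Marks are allowed only at ranks above one, so a subset [A] is encoded through its image under an
   injection [j] avoiding the ranks zero and one. *)
have [j jinj jP] : exists2 j : M -> M, injective j &
    forall a, ~ (phi @^-1` [set zero; one]) (j a).
  apply: (inj_avoid pinj ninj); apply: finite_preimage; last exact: finite_set2.
  by move=> a b _ _ /phi_inj.
have j_gt1 (A : set M) a : (j @` A) a -> olt le one (phi a).
  case=> c _ <-; split; last by move=> e; apply: (jP c); right.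
  by apply: omin => e; apply: (jP c); left.
have phis v a : olt le v (phi a) -> exists c, phi c = v.
  by move=> va; apply: wphi; apply: (wo_ltle wo) va (proj1 (phiw a)).
exists (fun A => tree_space (label_child le phi (j @` A)) R); split=> [A|A|A B AB].
- exact: label_tree_card pinj ninj.
- rewrite (label_derivative R wo phis zeroP oneP (@j_gt1 A)).
  apply/seteqP; split=> x //= wx.
  (* Every rank is below [w]: those of plain and marked labels by the choice of [phi], and [one]
     because it lies below the rank of some [j a]. *)
  suff /(wo_ltgt wo)/(_ wx) : olt le (label_rank phi zero one (label x)) w by [].
  have onew : olt le one w.
    by apply: (wo_ltle wo) (j_gt1 setT (j (n 0)) _) (proj1 (phiw _)); exists (n 0).
  by case: (label x) => [a|a||i] //=; apply: (wo_lelt wo) onew; apply: zmin.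
- move=> /(@homeomorphic_wild_limits _ _ wo) hom; apply: AB; apply/seteqP.
  (* Membership of [a] is read off from the existence of wild limits of rank [phi (j a)], on which
     homeomorphic spaces agree. *)
  have recover A' a : A' a <-> wild_limits wo
      (tree_space (label_child le phi (j @` A')) R) one (phi (j a)) !=set0.
    rewrite -(label_recover R wo phi_inj phis zeroP oneP (@j_gt1 A')).
    by split=> [|[c Ac /jinj <-]] //; exists a.
  by split=> a /recover/hom aP; apply/recover.
Qed.
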